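(* In a Markovian electric network on a finite connected graph $G=(V,E)$, for any disjoint non-empty $A,B\subset V$ there is a constant $R^{\text{eff}}_{AB}>0$ such that $$U_A-U_B=R^{\text{eff}}_{AB}\cdot i_A\qquad\text{for all }U_A,U_B\in\mathbb R,$$ where $i_A$ is the total incoming current to the set $A$ when the vertices of $A$ are held at constant potential $U_A$, the vertices of $B$ at constant potential $U_B$, and all other vertices are free.
   Context: Graphs are finite, connected and undirected, and loops are allowed; $x\sim y$ means that $x$ and $y$ are joined by an edge, with $x\sim x$ exactly when $x$ has a loop. An electric network on $G=(V,E)$ consists of resistances $R_{xy}=R_{yx}>0$ and amplifier parameters $\lambda_{xy}>0$ with $\lambda_{yx}=1/\lambda_{xy}$, given for all $x\sim y$, with $\lambda_{xx}=1$ on loops. Put $C_{xy}=1/R_{xy}$, $\gamma_{xy}=\sqrt{\lambda_{xy}}=1/\gamma_{yx}$, $D_{xy}=\frac{2\gamma_{xy}}{1+\lambda_{xy}}C_{xy}=D_{yx}$. The network is called Markovian if $\sum_{z\sim x}D_{xz}\gamma_{xz}=\sum_{z\sim x}D_{xz}\gamma_{zx}$ for all $x\in V$. Potentials $(u_x)_{x\in V}$ and currents are related by $i_{xy}=D_{xy}(\gamma_{yx}u_x-\gamma_{xy}u_y)$ for $x\sim y$. The incoming current to vertex $x$ is $i_x=\sum_{y\sim x}i_{xy}$; $x$ is free if $i_x=0$. For potentials prescribed on a nonempty set of vertices, with all others free, there is a unique solution $(u,i)$. The total incoming current to $A$ is $i_A=\sum_{x\in A}i_x$. *)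

(* Defs.v *)
From mathcomp Require Import all_boot all_order all_algebra.
From mathcomp Require Import reals.

Set Implicit Arguments.
Unset Strict Implicit.
Unset Printing Implicit Defensive.

Import Order.TTheory GRing.Theory Num.Theory.

Local Open Scope ring_scope.

(* [adj] is not required to be irreflexive: loops are allowed. *)
Record connected_graph (V : finType) := ConnectedGraph {
  adj : rel V;
  adj_sym : symmetric adj;
  adj_connected : forall x y, connect adj x y
}.

(* Resistances and amplifier parameters are only meaningful on edges: their
   values on pairs that are not adjacent are unconstrained and never used. *)
Record electric_network (R : realType) (V : finType) (G : connected_graph V) :=
  ElectricNetwork {
  resistance : V -> V -> R;
  amplifier : V -> V -> R;
  resistance_gt0 : forall x y, adj G x y -> 0 < resistance x y;
  resistance_sym : forall x y, adj G x y -> resistance y x = resistance x y;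
  amplifier_gt0 : forall x y, adj G x y -> 0 < amplifier x y;
  amplifier_inv : forall x y, adj G x y -> amplifier y x = (amplifier x y)^-1;
  amplifier_loop : forall x, adj G x x -> amplifier x x = 1
}.

Section Network.
Variables (R : realType) (V : finType) (G : connected_graph V).
Variable N : electric_network R G.
Implicit Types (x y : V) (A B : {set V}) (u : {ffun V -> R}).

Definition conductance x y : R := (resistance N x y)^-1.

Definition gamma x y : R := Num.sqrt (amplifier N x y).

Definition Dcoef x y : R :=
  2 * gamma x y / (1 + amplifier N x y) * conductance x y.

Definition markovian : Prop :=
  forall x, \sum_(z | adj G x z) Dcoef x z * gamma x z
          = \sum_(z | adj G x z) Dcoef x z * gamma z x.

Definition edge_current u x y : R :=
  Dcoef x y * (gamma y x * u x - gamma x y * u y).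

Definition vertex_current u x : R :=
  \sum_(y | adj G x y) edge_current u x y.

Definition free u x : Prop := vertex_current u x = 0.

Definition set_current u A : R := \sum_(x in A) vertex_current u x.

Definition held_at A UA B UB u : Prop :=
  [/\ forall x, x \in A -> u x = UA,
      forall x, x \in B -> u x = UB
    & forall x, x \notin A :|: B -> free u x].

End Network.

(* Main.v *)
Require Import Defs.
From HB Require Import structures.
From mathcomp Require Import all_boot all_order all_algebra.
From mathcomp Require Import reals.

Import Order.TTheory GRing.Theory Num.Theory.

Local Open Scope ring_scope.

(** The Markov condition is what makes the network behave like an ordinary one
    with possibly asymmetric conductances: it turns the current at [x] into
    [\sum_(y ~ x) w x y * (u x - u y)] with positive weights
    [w x y = D x y * gamma x y] ([vertex_current_diff]).  This Laplacian kills
    constants.  Connectedness then gives the maximum principle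
    ([max_attained_on_boundary]): a potential that is free off a non-empty set
    [S] takes its maximum on [S].  Hence potentials free off [S] are determined
    by their values on [S], and, since the defining linear system is square,
    they exist for any prescribed values ([harmonic_extension]).

    Let [h] be the solution with value 1 on [A] and 0 on [B].  By linearity and
    the invariance under constants, the solution for [UA] and [UB] is
    [(UA - UB) * h + UB], and its current into [A] is [(UA - UB) * i_A(h)].  So
    the resistance has to be [1 / i_A(h)], and only [i_A(h) > 0] is left.  As
    [h <= 1], every vertex of [A] receives a nonnegative current.  If all of
    these vanished, [h] would be free off [B] and zero on [B], hence zero
    everywhere, although it is 1 on [A]. *)

Lemma setUl_neq0 (T : finType) (A B : {set T}) :
  A != set0 -> A :|: B != set0.
Proof. by rewrite setU_eq0 negb_and => ->. Qed.

Section Harmonic.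
Context {R : realType} {V : finType} {G : connected_graph V}.
Context (N : electric_network R G).
Implicit Types (x y : V) (S A B : {set V}) (u v : {ffun V -> R}).

Lemma vertex_current_linear (a : R) u v x :
  vertex_current N [ffun y => a * u y + v y] x
    = a * vertex_current N u x + vertex_current N v x.
Proof.
rewrite /vertex_current mulr_sumr -big_split /=; apply: eq_bigr => y _.
rewrite /edge_current !ffunE; set d := Dcoef _ _ _; set g := gamma _ _ _.
set g' := gamma _ _ _.
rewrite !mulrDr !mulrN !mulrDr opprD addrACA.
by rewrite !(mulrCA a).
Qed.

Lemma weight_gt0 x y : adj G x y -> 0 < Dcoef N x y * gamma N x y.
Proof.
move=> xy; have l0 := amplifier_gt0 N xy.
have g0 : 0 < gamma N x y by rewrite sqrtr_gt0.
apply: mulr_gt0 => //; apply: mulr_gt0; last first.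
  by rewrite invr_gt0; apply: resistance_gt0.
by apply: divr_gt0; [apply: mulr_gt0 | apply: addr_gt0].
Qed.

Hypothesis hN : markovian N.

Lemma vertex_current_diff u x :
  vertex_current N u x
    = \sum_(y | adj G x y) Dcoef N x y * gamma N x y * (u x - u y).
Proof.
rewrite /vertex_current /edge_current.
under eq_bigr do rewrite mulrBr !mulrA.
under [RHS]eq_bigr do rewrite mulrBr.
by rewrite !sumrB -!mulr_suml hN.
Qed.

Lemma vertex_current_cst (c : R) x : vertex_current N [ffun=> c] x = 0.
Proof.
rewrite vertex_current_diff big1 // => y _.
by rewrite !ffunE subrr mulr0.
Qed.

(** A zero sum of nonnegative terms: at a free vertex the potential is a
    weighted mean of the neighbouring ones, so a maximum spreads. *)
Lemma max_spreads_to_neighbours u x :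
  (forall y, u y <= u x) -> Defs.free N u x -> forall y, adj G x y -> u y = u x.
Proof.
move=> umax; rewrite /Defs.free vertex_current_diff => /eqP.
rewrite psumr_eq0 => [/allP u0 y xy|y xy]; last first.
  by rewrite mulr_ge0 ?subr_ge0 // ltW ?weight_gt0.
have := u0 y (mem_index_enum y); rewrite xy mulf_eq0 gt_eqF ?weight_gt0 //=.
by rewrite subr_eq0 => /eqP.
Qed.

(** If no maximum point lay in [S], the set of maximum points would be closed
    under adjacency, hence all of [V] by connectedness. *)
Lemma max_attained_on_boundary S u : S != set0 ->
  (forall x, x \notin S -> Defs.free N u x) ->
  exists2 x, x \in S & forall y, u y <= u x.
Proof.
move=> /set0Pn[s sS] ufree.
have [m _ mmax] := @arg_maxP _ _ _ s xpredT u isT.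
have {}mmax y : u y <= u m by apply: mmax.
pose M := [pred x | u x == u m].
have [/exists_inP[x xS /eqP ux]|noM] := boolP [exists x in S, u x == u m].
  by exists x => // y; rewrite ux.
have Mclosed : closed (adj G) M.
  apply: intro_closed; first exact: sym_connect_sym (adj_sym G).
  move=> x y xy; rewrite !inE => /eqP ux.
  have xS : x \notin S.
    by apply: contra noM => xS; apply/exists_inP; exists x; rewrite ?ux.
  have xmax z : u z <= u x by rewrite ux.
  by rewrite (max_spreads_to_neighbours u x xmax (ufree x xS) y xy) ux.
have := closed_connect Mclosed (adj_connected G m s).
rewrite !inE eqxx => /esym us.
by case/negP: noM; apply/exists_inP; exists s.
Qed.

Lemma potential_le S u (c : R) : S != set0 ->
  (forall x, x \notin S -> Defs.free N u x) ->
  (forall x, x \in S -> u x <= c) -> forall x, u x <= c.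
Proof.
move=> S0 ufree uc x; have [s sS smax] := max_attained_on_boundary S u S0 ufree.
exact: le_trans (smax x) (uc s sS).
Qed.

Lemma potential_unique S u v : S != set0 ->
  (forall x, x \notin S -> Defs.free N u x) ->
  (forall x, x \notin S -> Defs.free N v x) ->
  (forall x, x \in S -> u x = v x) -> u = v.
Proof.
move=> S0.
(* Each inequality is the maximum principle for a difference. *)
have le (u1 u2 : {ffun V -> R}) : (forall x, x \notin S -> Defs.free N u1 x) ->
    (forall x, x \notin S -> Defs.free N u2 x) ->
    (forall x, x \in S -> u1 x = u2 x) -> forall x, u1 x <= u2 x.
  move=> f1 f2 e x; pose w : {ffun V -> R} := [ffun y => -1 * u2 y + u1 y].
  suff : w x <= 0 by rewrite ffunE mulN1r addrC subr_le0.
  apply: (potential_le S) => // y yS; last first.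
    by rewrite ffunE e // mulN1r addNr.
  by rewrite /Defs.free vertex_current_linear f1 ?f2 // mulr0 addr0.
move=> fu fv e; apply/ffunP => x; apply/le_anti/andP; split; apply: le => //.
by move=> y yS; rewrite e.
Qed.

(** Solvability of the Dirichlet problem, by dimension count: the operator
    that returns the potential on [S] and the current off [S] is an injective
    endomorphism of a finite-dimensional space. *)
Lemma harmonic_extension S (f : V -> R) : S != set0 ->
  exists2 u : {ffun V -> R}, (forall x, x \in S -> u x = f x)
    & forall x, x \notin S -> Defs.free N u x.
Proof.
move=> S0.
pose T (u : {ffun V -> R^o}) : {ffun V -> R^o} :=
  [ffun x => if x \in S then u x else vertex_current N u x].
have Tlin : linear T.
  move=> a u v; apply/ffunP => x; rewrite !ffunE.
  case: ifP => // _.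
  rewrite -[RHS]vertex_current_linear; congr vertex_current.
  by apply/ffunP => y; rewrite !ffunE.
pose TL := GRing.isLinear.Build _ _ _ _ T Tlin.
pose Tl : {linear _ -> _} := HB.pack T TL.
have TE u : linfun Tl u = T u by rewrite lfunE.
have ker0 : lker (linfun Tl) == 0%VS.
  apply/lker0P => u v; rewrite !TE => /ffunP uv.
  (* Injectivity is tested on the difference, which is compared with 0. *)
  pose w : {ffun V -> R} := [ffun y => -1 * v y + u y].
  have wfree x : x \notin S -> Defs.free N w x.
    move=> xS; have := uv x; rewrite !ffunE (negPf xS) => e.
    by rewrite /Defs.free vertex_current_linear e mulN1r addNr.
  have w0 : w = [ffun=> 0].
    apply: (potential_unique S) => // [x _|x xS].
      exact: vertex_current_cst.
    by have := uv x; rewrite !ffunE xS => ->; rewrite mulN1r addNr.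
  apply/ffunP => x; move/ffunP/(_ x): w0; rewrite !ffunE mulN1r addrC.
  by move/eqP; rewrite subr_eq0 => /eqP.
pose g : {ffun V -> R^o} := [ffun x => if x \in S then f x else 0].
pose u := ((linfun Tl)^-1)%VF g.
have /ffunP Tu : T u = g by rewrite -TE lker0_lfunVK.
exists u => x xS; have := Tu x; rewrite !ffunE; first by rewrite xS.
by rewrite (negPf xS).
Qed.

Lemma held_at_unique A B (UA UB : R) u : A != set0 ->
  held_at N A UA B UB u -> unique (held_at N A UA B UB) u.
Proof.
move=> A0 hu; split=> // v [vA vB vfree]; case: hu => uA uB ufree.
apply: (potential_unique (A :|: B)) => // [|x]; first exact: setUl_neq0.
by rewrite inE => /orP[xS|xS]; [rewrite uA ?vA | rewrite uB ?vB].
Qed.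

(** The currents into [A] are nonnegative by the maximum principle; if they all
    vanished, only [B] would hold the potential, and [u] would be zero. *)
Lemma set_current_unit_gt0 A B u : A != set0 -> B != set0 ->
  held_at N A 1 B 0 u -> 0 < set_current N u A.
Proof.
move=> A0 B0 [uA uB ufree].
have u_le1 x : u x <= 1.
  apply: (potential_le (A :|: B)) => // [|y]; first exact: setUl_neq0.
  by rewrite inE => /orP[yS|yS]; [rewrite uA | rewrite uB ?ler01].
have cur_ge0 x : x \in A -> 0 <= vertex_current N u x.
  move=> xA; rewrite vertex_current_diff sumr_ge0 // => y xy.
  by rewrite (uA x xA) mulr_ge0 ?subr_ge0 // ltW ?weight_gt0.
rewrite lt_neqAle sumr_ge0 // andbT eq_sym; apply/negP.
rewrite psumr_eq0 // => /allP cur0.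
have u0 : u = [ffun=> 0].
  apply: (potential_unique B) => // x xB; last by rewrite uB ?ffunE.
    have [xA|xA] := boolP (x \in A); last first.
      by apply: ufree; rewrite inE negb_or xA.
    by apply/eqP; have := cur0 x (mem_index_enum x); rewrite xA.
  exact: vertex_current_cst.
case/set0Pn: A0 => a aA; have := uA a aA; rewrite u0 ffunE => /eqP.
by rewrite eq_sym oner_eq0.
Qed.

End Harmonic.

Theorem theorem3p7 (R : realType) (V : finType) (G : connected_graph V)
    (N : electric_network R G) (hN : markovian N)
    (A B : {set V}) (hA : A != set0) (hB : B != set0)
    (hAB : [disjoint A & B]) :
  exists Reff : R, 0 < Reff /\
    forall UA UB : R,
      exists u : {ffun V -> R},
        unique (held_at N A UA B UB) u /\
        UA - UB = Reff * set_current N u A.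
Proof.
have AB0 : A :|: B != set0 by apply: setUl_neq0.
have [h hS hfree] :=
  harmonic_extension N hN (A :|: B) (fun x => (x \in A)%:R) AB0.
have h1 x : x \in A -> h x = 1 by move=> xA; rewrite hS ?inE xA.
have h0 x : x \in B -> h x = 0.
  by move=> xB; rewrite hS ?inE ?xB ?orbT // (disjointFl hAB xB).
have iA_gt0 : 0 < set_current N h A.
  exact: (set_current_unit_gt0 N hN A B).
exists (set_current N h A)^-1; split; first by rewrite invr_gt0.
move=> UA UB.
pose c : {ffun V -> R} := [ffun=> UB].
pose u : {ffun V -> R} := [ffun x => (UA - UB) * h x + c x].
have cur_u x : vertex_current N u x = (UA - UB) * vertex_current N h x.
  by rewrite vertex_current_linear vertex_current_cst // addr0.
exists u; split.
  apply: held_at_unique => //; split=> x xS.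
  - by rewrite !ffunE h1 // mulr1 subrK.
  - by rewrite !ffunE h0 // mulr0 add0r.
  - by rewrite /Defs.free cur_u hfree // mulr0.
rewrite /set_current (eq_bigr _ (fun x _ => cur_u x)) -mulr_sumr.
by rewrite mulrCA mulVf ?mulr1 // gt_eqF.
Qed.
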